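(* Let $(A,\prec,\succ)$ be a noncommutative Novikov algebra and $r\in A\otimes A$. Then $r$ is an antisymmetric nondegenerate solution of the Novikov Yang-Baxter equation in $(A,\prec,\succ)$ if and only if $r^\sharp:A^*\to A$ is invertible and $(A,\prec,\succ,\mathfrak B)$ is a quasi-Frobenius noncommutative Novikov algebra, where the bilinear form $\mathfrak B$ on $A$ is defined by $$\mathfrak B(x,y):=\langle(r^\sharp)^{-1}(x),y\rangle,\quad x,y\in A.$$
   Context: $\mathbf k$ is a field of characteristic $0$; all vector spaces are finite-dimensional over $\mathbf k$, tensor products are over $\mathbf k$. A noncommutative Novikov algebra is a vector space $A$ with bilinear operations $\prec,\succ$ such that, with $\bullet:=\prec+\succ$, $(x\succ y)\prec z=x\succ(y\prec z)$ and $(x\prec y)\bullet z=x\bullet(y\succ z)$ for all $x,y,z\in A$. For $r=\sum_iu_i\otimes v_i\in A\otimes A$, the Novikov Yang-Baxter equation in $(A,\prec,\succ)$ is $$\sum_{i,j}\big(u_i\succ u_j\otimes v_i\otimes v_j+u_i\otimes u_j\otimes v_i\prec v_j+u_i\otimes u_j\bullet v_i\otimes v_j\big)=0 .$$ $r$ is antisymmetric if $\sigma(r)=-r$ with $\sigma(x\otimes y)=y\otimes x$. The map $r^\sharp:A^*\to A$ is $r^\sharp(a^* )=\sum_i\langle a^*,u_i\rangle v_i$, equivalently $\langle r^\sharp(a^* ),b^*\rangle=\langle r,a^*\otimes b^*\rangle$; $r$ is nondegenerate if $r^\sharp$ is an isomorphism. A quasi-Frobenius noncommutative Novikov algebra $(A,\prec,\succ,\mathfrak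 B)$ is a noncommutative Novikov algebra with an antisymmetric nondegenerate bilinear form $\mathfrak B$ satisfying $\mathfrak B(x\prec y,z)+\mathfrak B(y\succ z,x)-\mathfrak B(z\bullet x,y)=0$ for all $x,y,z\in A$. *)

(* Defs.v *)
From HB Require Import structures.
From mathcomp Require Import all_boot all_algebra.

Set Implicit Arguments.
Unset Strict Implicit.
Unset Printing Implicit Defensive.

Import GRing.Theory.
Local Open Scope ring_scope.

(* U (x) V is realized by coordinate matrices in the bases vbasis {:U} and
   vbasis {:V}.  The lemmas tensor_bilinear, tlift_linear, tliftE and tensor_ext
   establish the universal property, so nothing depends on these bases. *)
Definition tensor (K : fieldType) (U V : vectType K) : Type :=
  'M[K]_(\dim {:U}, \dim {:V}).
HB.instance Definition _ (K : fieldType) (U V : vectType K) :=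
  Vector.copy (tensor U V) 'M[K]_(\dim {:U}, \dim {:V}).

Definition tens (K : fieldType) (U V : vectType K) (u : U) (v : V) :
    tensor U V :=
  \matrix_(i, j) (coord (vbasis {:U}) i u * coord (vbasis {:V}) j v).

Notation "u '⊗' v" := (tens u v) (at level 40, left associativity) : ring_scope.

(* The linear map U (x) V -> W induced by a bilinear f. *)
Definition tlift (K : fieldType) (U V W : vectType K) (f : U -> V -> W)
    (r : tensor U V) : W :=
  \sum_i \sum_j r i j *: f (vbasis {:U})`_i (vbasis {:V})`_j.

Section TensorTheory.
Variables (K : fieldType) (U V W : vectType K).

Lemma tensor_bilinear : bilinear_for *:%R *:%R (@tens K U V).
Proof.
split=> [v|u] a x y; apply/matrixP=> i j; rewrite !mxE linearP /=.
- by rewrite mulrDl mulrA.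
- by rewrite mulrDr mulrCA.
Qed.

Lemma tlift_linear (f : U -> V -> W) : linear (tlift f).
Proof.
move=> a r s; rewrite /tlift scaler_sumr -big_split; apply: eq_bigr => i _ /=.
rewrite scaler_sumr -big_split; apply: eq_bigr => j _ /=.
by rewrite !mxE scalerDl scalerA.
Qed.

HB.instance Definition _ (f : U -> V -> W) :=
  GRing.isLinear.Build K (tensor U V) W *:%R (tlift f) (tlift_linear f).

Lemma tliftE (f : U -> V -> W) (u : U) (v : V) :
  bilinear_for *:%R *:%R f -> tlift f (u ⊗ v) = f u v.
Proof.
case=> fl fr.
pose F1 := GRing.isLinear.Build _ _ _ _ _ (fl v).
pose g1 : {linear U -> W} := HB.pack (f^~ v) F1.
rewrite {2}(coord_vbasis (memvf u)) -[f _ v]/(g1 _) linear_sum /tlift.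
apply: eq_bigr => i _; rewrite linearZ /=.
set e := (vbasis {:U})`_i.
pose F2 := GRing.isLinear.Build _ _ _ _ _ (fr e).
pose g2 : {linear V -> W} := HB.pack (f e) F2.
rewrite {2}(coord_vbasis (memvf v)) -[f e _]/(g2 _) linear_sum scaler_sumr.
by apply: eq_bigr => j _; rewrite mxE linearZ scalerA.
Qed.

Lemma tensor_basis_sum (r : tensor U V) :
  r = \sum_i \sum_j r i j *: ((vbasis {:U})`_i ⊗ (vbasis {:V})`_j).
Proof.
apply/matrixP=> k l; rewrite [RHS]summxE.
have cU (i : 'I__) : coord (vbasis {:U}) k (vbasis {:U})`_i = (k == i)%:R.
  by rewrite coord_free ?(basis_free (vbasisP _)) // eq_sym.
have cV (j : 'I__) : coord (vbasis {:V}) l (vbasis {:V})`_j = (l == j)%:R.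
  by rewrite coord_free ?(basis_free (vbasisP _)) // eq_sym.
rewrite (bigD1 k) //= [X in _ + X]big1 ?addr0 => [|i /negPf ne]; last first.
  rewrite summxE big1 // => j _.
  by rewrite !mxE cU eq_sym ne mul0r mulr0.
rewrite summxE (bigD1 l) //= big1 ?addr0 => [|j /negPf ne].
  by rewrite !mxE cU cV !eqxx !mulr1.
by rewrite !mxE cV eq_sym ne !mulr0.
Qed.

Lemma tensor_ext (f g : {linear tensor U V -> W}) :
  (forall u v, f (u ⊗ v) = g (u ⊗ v)) -> f =1 g.
Proof.
move=> fg r; rewrite (tensor_basis_sum r) !linear_sum; apply: eq_bigr => i _.
by rewrite !linear_sum; apply: eq_bigr => j _; rewrite !linearZ fg.
Qed.

Lemma tensor_decomp (r : tensor U V) :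
  exists (n : nat) (u : 'I_n -> U) (v : 'I_n -> V), r = \sum_i u i ⊗ v i.
Proof.
exists (\dim {:U}), (fun i => (vbasis {:U})`_i),
  (fun i => \sum_j r i j *: (vbasis {:V})`_j).
rewrite {1}(tensor_basis_sum r); apply: eq_bigr => i _.
pose F := GRing.isLinear.Build _ _ _ _ _ (tensor_bilinear.2 (vbasis {:U})`_i).
pose g : {linear V -> tensor U V} := HB.pack (tens (vbasis {:U})`_i) F.
rewrite -[tens _ (\sum_j _)]/(g _) linear_sum; apply: eq_bigr => j _.
by rewrite linearZ.
Qed.

End TensorTheory.

Section Novikov.
Variables (K : fieldType) (A : vectType K).

Definition bullet (prec succ : A -> A -> A) (x y : A) : A :=
  prec x y + succ x y.

Definition nc_novikov (prec succ : {bilinear A -> A -> A}) : Prop :=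
  (forall x y z : A, prec (succ x y) z = succ x (prec y z)) /\
  (forall x y z : A,
     bullet prec succ (prec x y) z = bullet prec succ x (succ y z)).

(* Iterating tlift over r sums the inner expression over pairs of terms of any
   decomposition r = \sum_i u i ⊗ v i, see nybe_lhsE. *)
Definition nybe_lhs (prec succ : {bilinear A -> A -> A}) (r : tensor A A) :
    tensor (tensor A A) A :=
  tlift (fun ui vi => tlift (fun uj vj =>
      succ ui uj ⊗ vi ⊗ vj
    + ui ⊗ uj ⊗ prec vi vj
    + ui ⊗ bullet prec succ uj vi ⊗ vj) r) r.

Definition nybe (prec succ : {bilinear A -> A -> A}) (r : tensor A A) : Prop :=
  nybe_lhs prec succ r = 0.

Definition flip (r : tensor A A) : tensor A A := tlift (fun x y => y ⊗ x) r.

Definition tensor_antisymmetric (r : tensor A A) : Prop := flip r = - r.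

Definition sharp_fun (r : tensor A A) (a : 'Hom(A, K^o)) : A :=
  tlift (fun u v => (a u : K) *: v) r.

Definition sharp (r : tensor A A) : 'Hom('Hom(A, K^o), A) :=
  linfun (sharp_fun r).

Definition tensor_nondegenerate (r : tensor A A) : Prop := bijective (sharp r).

(* (sharp r)^-1%VF is total; it is the two-sided inverse of sharp r when
   sharp r is bijective. *)
Definition sharp_form (r : tensor A A) (x y : A) : K :=
  ((sharp r)^-1%VF x) y.

Definition form_nondegenerate (B : A -> A -> K) : Prop :=
  (forall x, (forall y, B x y = 0) -> x = 0) /\
  (forall y, (forall x, B x y = 0) -> y = 0).

Definition quasi_frobenius (prec succ : {bilinear A -> A -> A})
    (B : A -> A -> K) : Prop :=
  [/\ nc_novikov prec succ,
      bilinear_for *%R *%R B,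
      forall x y, B x y = - B y x,
      form_nondegenerate B &
      forall x y z,
        B (prec x y) z + B (succ y z) x - B (bullet prec succ z x) y = 0].

Lemma flipE n (u v : 'I_n -> A) :
  flip (\sum_i u i ⊗ v i) = \sum_i v i ⊗ u i.
Proof.
rewrite /flip linear_sum; apply: eq_bigr => i _ /=; rewrite tliftE //.
by split=> w; [apply: (@tensor_bilinear K A A).2|apply: (@tensor_bilinear K A A).1].
Qed.

Lemma sharp_fun_linear r : linear (sharp_fun r).
Proof.
move=> c a b; rewrite /sharp_fun /tlift scaler_sumr -big_split.
apply: eq_bigr => i _; rewrite /= scaler_sumr -big_split; apply: eq_bigr => j _.
by rewrite add_lfunE scale_lfunE scalerDl scalerDr /= !scalerA mulrCA mulrA.
Qed.

HB.instance Definition _ (r : tensor A A) :=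
  GRing.isLinear.Build K 'Hom(A, K^o) A *:%R (sharp_fun r)
    (sharp_fun_linear r).

Lemma sharpE n (u v : 'I_n -> A) (a : 'Hom(A, K^o)) :
  sharp (\sum_i u i ⊗ v i) a = \sum_i (a (u i) : K) *: v i.
Proof.
rewrite lfunE /= /sharp_fun linear_sum; apply: eq_bigr => i _ /=.
rewrite tliftE //; split=> [w|w] c x y /=; rewrite ?linearP /= ?scalerDl ?scalerA //.
Qed.

Lemma nybe_lhsE (prec succ : {bilinear A -> A -> A}) n (u v : 'I_n -> A) :
  nybe_lhs prec succ (\sum_i u i ⊗ v i) =
  \sum_i \sum_j (succ (u i) (u j) ⊗ v i ⊗ v j
               + u i ⊗ u j ⊗ prec (v i) (v j)
               + u i ⊗ bullet prec succ (u j) (v i) ⊗ v j).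
Proof.
have tl (X Y : vectType K) c (x x' : X) (y : Y) :
  (c *: x + x') ⊗ y = c *: (x ⊗ y) + x' ⊗ y := (tensor_bilinear X Y).1 y c x x'.
have tr (X Y : vectType K) c (x : X) (y y' : Y) :
  x ⊗ (c *: y + y') = c *: (x ⊗ y) + x ⊗ y' := (tensor_bilinear X Y).2 x c y y'.
have D3 (c : K) (x1 x2 x3 y1 y2 y3 : tensor (tensor A A) A) :
    (c *: x1 + y1) + (c *: x2 + y2) + (c *: x3 + y3)
    = c *: (x1 + x2 + x3) + (y1 + y2 + y3).
  by rewrite !scalerDr [LHS](AC (2*2*2) ((1*3*5)*(2*4*6))).
have bl (c : K) x x' y : bullet prec succ (c *: x + x') y =
    c *: bullet prec succ x y + bullet prec succ x' y.
  by rewrite /bullet !linearPl /= scalerDr addrACA.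
have br (c : K) x y y' : bullet prec succ x (c *: y + y') =
    c *: bullet prec succ x y + bullet prec succ x y'.
  by rewrite /bullet !linearPr /= scalerDr addrACA.
rewrite /nybe_lhs [LHS]linear_sum.
apply: eq_bigr => i _ /=; rewrite tliftE; last first.
  split=> w c x y /=; rewrite /tlift scaler_sumr -big_split; apply: eq_bigr => k _ /=;
  rewrite scaler_sumr -big_split; apply: eq_bigr => l _ /=;
  rewrite scalerA [c * _]mulrC -scalerA -scalerDr; congr (_ *: _).
    by rewrite linearPl /= !tl D3.
  by rewrite br linearPl !(tl, tr) D3.
rewrite linear_sum; apply: eq_bigr => j _ /=; rewrite tliftE //.
split=> w c x y /=.
  by rewrite bl linearPr !(tl, tr) D3.
by rewrite linearPr !tr D3.
Qed.

End Novikov.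

(* Main.v *)
From HB Require Import structures.
Require Import Defs.
From mathcomp Require Import all_boot all_algebra.
Import GRing.Theory.
Local Open Scope ring_scope.

(** Write [S] for [sharp r]. A tensor vanishes as soon as all products of
    linear forms kill it, so every condition on [r] can be tested on linear forms
    and then, when [S] is bijective, on the vectors [x = S a], [y = S b],
    [z = S c], for which [B x t = a t], [B y t = b t] and [B z t = c t] with
    [B = sharp_form r].

    Contracting [r] in its first factor gives [S], and contracting it in its
    second factor gives the transpose of [S]. Hence [r] is antisymmetric iff
    [b (S a) = - a (S b)] for all [a] and [b] ([antisymmetric_sharpP]), i.e. iff
    [B] is antisymmetric. When this holds, pairing the left-hand side of the
    Novikov Yang-Baxter equation with [a ⊗ b ⊗ c] gives ([contract3_nybe])
      [a (S b ≻ S c) + c (S a ≺ S b) - b (S c • S a)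
       = B (x, y ≻ z) + B (z, x ≺ y) - B (y, z • x)],
    which by antisymmetry of [B] is the opposite of
      [B (x ≺ y, z) + B (y ≻ z, x) - B (z • x, y)].
    As [S] is onto, all triples [(x, y, z)] arise, so the Novikov Yang-Baxter
    equation for [r] is the quasi-Frobenius identity for [B]. *)

(** * Separation of tensors by linear forms *)

Lemma hom_separates (K : fieldType) (U : vectType K) (x : U) :
  (forall a : 'Hom(U, K^o), (a x : K) = 0) -> x = 0.
Proof.
move=> ax0; rewrite (coord_vbasis (memvf x)); apply: big1 => i _.
have := ax0 (linfun (coord (vbasis {:U}) i : U -> K^o)).
by rewrite lfunE /= => ->; rewrite scale0r.
Qed.

(** The partial evaluation [id ⊗ c : U ⊗ V -> U]. Iterating it evaluates
    functionals on tensors of any order while staying linear at each stage. *)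
Definition contract {K : fieldType} {U V : vectType K} (c : 'Hom(V, K^o))
    (t : tensor U V) : U :=
  tlift (fun u v => (c v : K) *: u) t.

HB.instance Definition _ (K : fieldType) (U V : vectType K)
    (c : 'Hom(V, K^o)) :=
  GRing.isLinear.Build K (tensor U V) U *:%R (contract c) (tlift_linear _).

Lemma contract_tens (K : fieldType) (U V : vectType K) (c : 'Hom(V, K^o))
    (u : U) (v : V) : contract c (u ⊗ v) = (c v : K) *: u.
Proof.
rewrite /contract tliftE //; split=> w k x y /=.
  by rewrite scalerDr !scalerA mulrC.
by rewrite linearP /= scalerDl scalerA.
Qed.

(** Contracting with the [j]-th coordinate form extracts column [j] of the
    coordinate matrix of [t], as a vector of [U]; that vector vanishes only if
    the column does, because the basis of [U] is free. *)
Lemma contract_separates (K : fieldType) (U V : vectType K) (t : tensor U V) :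
  (forall c, contract c t = 0) -> t = 0.
Proof.
move=> ct0; apply/matrixP => i j; rewrite [RHS]mxE.
pose c := linfun (coord (vbasis {:V}) j : V -> K^o).
have cE (l : 'I_(\dim {:V})) : (c (vbasis {:V})`_l : K) = (l == j)%:R.
  by rewrite lfunE /= coord_free ?(basis_free (vbasisP _)) // eq_sym.
have col0 : \sum_k t k j *: (vbasis {:U})`_k = 0.
  rewrite -[RHS](ct0 c) /contract /tlift; apply: eq_bigr => k _.
  rewrite (bigD1 j) //= big1 ?addr0 => [|l /negPf ne].
    by rewrite cE eqxx scale1r.
  by rewrite cE ne scale0r scaler0.
have /freeP free_e := basis_free (vbasisP {:U}).
exact: free_e (fun k => t k j) col0 i.
Qed.

Lemma contract3_separates (K : fieldType) (U V W : vectType K)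
    (t : tensor (tensor U V) W) :
  (forall (a : 'Hom(U, K^o)) b c, (a (contract b (contract c t)) : K) = 0) ->
  t = 0.
Proof.
move=> t0; apply: contract_separates => c; apply: contract_separates => b.
by apply: hom_separates => a; apply: t0.
Qed.

(** * Antisymmetry and the Novikov Yang-Baxter equation on linear forms *)

Section SharpAndContract.
Context {K : fieldType} {A : vectType K}.
Implicit Types (r : tensor A A) (a b c : 'Hom(A, K^o)).

Lemma contract_sum_tens n (u v : 'I_n -> A) c :
  contract c (\sum_i u i ⊗ v i) = \sum_i (c (v i) : K) *: u i.
Proof. by rewrite linear_sum; apply: eq_bigr => i _ /=; exact: contract_tens. Qed.

Lemma contract_flip r a : contract a (flip r) = sharp r a.
Proof.
have [n [u [v ->]]] := tensor_decomp r.
by rewrite flipE contract_sum_tens sharpE.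
Qed.

Lemma contract_transpose r a b :
  (a (contract b r) : K) = (b (sharp r a) : K).
Proof.
have [n [u [v ->]]] := tensor_decomp r.
rewrite contract_sum_tens sharpE !linear_sum; apply: eq_bigr => i _ /=.
by rewrite !linearZ /= /GRing.scale /= mulrC.
Qed.

Lemma antisymmetric_contract r :
  tensor_antisymmetric r -> forall a, contract a r = - sharp r a.
Proof. by move=> anti a; rewrite -contract_flip anti linearN opprK. Qed.

(** Contracting [flip r] and [r] in the second factor gives [sharp r] and its
    transpose, so antisymmetry of [r] is that of the map [sharp r]. *)
Lemma antisymmetric_sharpP r :
  tensor_antisymmetric r <->
  forall a b, (b (sharp r a) : K) = - (a (sharp r b) : K).
Proof.
split=> [anti a b | anti].
  by rewrite -contract_transpose antisymmetric_contract // linearN.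
apply/eqP; rewrite -addr_eq0; apply/eqP; apply: contract_separates => a.
apply: hom_separates => b.
by rewrite linearD /= contract_flip linearD /= contract_transpose anti addNr.
Qed.

(** In each of the three terms one tensor leg carries a product of one component
    from each copy of [r], and the other components stand alone in the other two
    legs. Evaluating a lone first component leaves [sharp r] in the product;
    evaluating a lone second component leaves [contract _ r]. *)
Lemma contract3_nybe_lhs (prec succ : {bilinear A -> A -> A}) r a b c :
  (a (contract b (contract c (nybe_lhs prec succ r))) : K) =
  (a (succ (contract b r) (contract c r)) : K)
  + (c (prec (sharp r a) (sharp r b)) : K)
  + (b (bullet prec succ (contract c r) (sharp r a)) : K).
Proof.
have [n [u [v ->]]] := tensor_decomp r.
have sumE (d e h : 'Hom(A, K^o)) (f f' g g' : 'I_n -> A)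
    (m : {bilinear A -> A -> A}) :
  (h (m (\sum_i (d (f i) : K) *: g i) (\sum_i (e (f' i) : K) *: g' i)) : K) =
  \sum_i \sum_j
    ((d (f i) : K) * (e (f' j) : K) * (h (m (g i) (g' j)) : K)).
  rewrite linear_sumlz linear_sum; apply: eq_bigr => i _ /=.
  rewrite linear_sumr linear_sum; apply: eq_bigr => j _ /=.
  by rewrite linearZl /= linearZr !linearZ /= /GRing.scale /= mulrA.
rewrite nybe_lhsE !sharpE !contract_sum_tens /bullet linearD /= !sumE.
(* The products [u j • v i] list the outer index [i] second, so their double
   sums come out in the opposite order. *)
rewrite [X in _ + (X + _)]exchange_big [X in _ + (_ + X)]exchange_big /=.
rewrite -!big_split (linear_sum (contract c)) (linear_sum (contract b)).
rewrite linear_sum; apply: eq_bigr => i _ /=.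
rewrite -!big_split (linear_sum (contract c)) (linear_sum (contract b)).
rewrite linear_sum; apply: eq_bigr => j _ /=.
rewrite !(linearD (contract c)) /= !contract_tens !(linearD (contract b)) /=.
rewrite !(linearZ_LR (contract b)) /= !contract_tens !linearD /= !linearZ /=.
rewrite /GRing.scale /= mulrDl mulrDr; congr (_ + _ + (_ + _)).
- by rewrite mulrCA mulrA.
- by rewrite mulrC; congr (_ * _); rewrite mulrC.
- by rewrite mulrA mulrAC.
- by rewrite mulrA mulrAC.
Qed.

Lemma contract3_nybe (prec succ : {bilinear A -> A -> A}) r a b c :
  tensor_antisymmetric r ->
  (a (contract b (contract c (nybe_lhs prec succ r))) : K) =
  (a (succ (sharp r b) (sharp r c)) : K)
  + (c (prec (sharp r a) (sharp r b)) : K)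
  - (b (bullet prec succ (sharp r c) (sharp r a)) : K).
Proof.
have Nl (m : {bilinear A -> A -> A}) x y : m (- x) y = - m x y.
  exact: linearNl.
have Nr (m : {bilinear A -> A -> A}) x y : m x (- y) = - m x y.
  exact: linearNr.
move=> anti; rewrite contract3_nybe_lhs !(antisymmetric_contract r anti).
by rewrite /bullet !Nl Nr opprK -opprD linearN.
Qed.

(** * The bilinear form inverse to [sharp r] *)

Lemma sharp_form_sharp r a t :
  bijective (sharp r) -> sharp_form r (sharp r a) t = a t.
Proof.
move=> bijS; rewrite /sharp_form lker0_lfunK //.
by apply/lker0P; apply: bij_inj.
Qed.

Lemma sharp_form_bilinear r : bilinear_for *%R *%R (sharp_form r).
Proof.
split=> [t|x] k y z; rewrite /sharp_form; last by rewrite linearP.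
by rewrite linearP add_lfunE scale_lfunE.
Qed.

Lemma sharp_form_nondegenerate r :
  bijective (sharp r) -> form_nondegenerate (sharp_form r).
Proof.
move=> bijS; have [g _ gK] := bijS; split=> [x x0|y y0].
  rewrite -(gK x); suff ->: g x = 0 by rewrite linear0.
  apply/lfunP => t; rewrite zero_lfunE -[RHS](x0 t) -{2}(gK x).
  by rewrite sharp_form_sharp.
by apply: hom_separates => a; rewrite -(sharp_form_sharp r a y bijS) y0.
Qed.

Lemma sharp_form_antisymmetricP r :
  bijective (sharp r) ->
  tensor_antisymmetric r <->
  forall x y, sharp_form r x y = - sharp_form r y x.
Proof.
move=> bijS; have [g _ gK] := bijS.
split=> [/antisymmetric_sharpP anti x y | antiB].
  by rewrite -(gK x) -(gK y) !sharp_form_sharp // anti.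
apply/antisymmetric_sharpP => a b.
by rewrite -!(sharp_form_sharp r _ _ bijS) antiB.
Qed.

(** Up to sign both sides are the same trilinear expression, evaluated on forms
    [a], [b], [c] on the left and on their images under the surjective [sharp r]
    on the right. *)
Lemma nybe_sharp_formP (prec succ : {bilinear A -> A -> A}) r :
  bijective (sharp r) -> tensor_antisymmetric r ->
  nybe prec succ r <->
  forall x y z, sharp_form r (prec x y) z + sharp_form r (succ y z) x
                - sharp_form r (bullet prec succ z x) y = 0.
Proof.
move=> bijS anti; have antiB := (sharp_form_antisymmetricP r bijS).1 anti.
have pairing a b c :
    (a (contract b (contract c (nybe_lhs prec succ r))) : K) =
    - (sharp_form r (prec (sharp r a) (sharp r b)) (sharp r c)
       + sharp_form r (succ (sharp r b) (sharp r c)) (sharp r a)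
       - sharp_form r (bullet prec succ (sharp r c) (sharp r a)) (sharp r b)).
  rewrite contract3_nybe // !(antiB (_ _ _) (sharp r _)).
  rewrite !(sharp_form_sharp r _ _ bijS) !opprD !opprK.
  by congr (_ - _); rewrite addrC.
have [g _ gK] := bijS; split=> [ybe x y z | qf].
  apply: oppr_inj; rewrite -(gK x) -(gK y) -(gK z) -pairing ybe.
  by rewrite !linear0 oppr0.
by apply: contract3_separates => a b c; rewrite pairing qf oppr0.
Qed.

End SharpAndContract.

Theorem proposition4p6 (K : fieldType) (charK0 : [pchar K] =i pred0)
    (A : vectType K) (prec succ : {bilinear A -> A -> A})
    (novA : nc_novikov prec succ) (r : tensor A A) :
  [/\ tensor_antisymmetric r, tensor_nondegenerate r & nybe prec succ r]
  <-> (bijective (sharp r) /\ quasi_frobenius prec succ (sharp_form r)).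
Proof.
split=> [[anti bijS ybe] | [bijS [_ _ antiB _ qf]]].
  split=> //; split=> //.
  - exact: sharp_form_bilinear.
  - exact/sharp_form_antisymmetricP.
  - exact: sharp_form_nondegenerate.
  - exact/nybe_sharp_formP.
have anti : tensor_antisymmetric r by apply/sharp_form_antisymmetricP.
by split=> //; apply/nybe_sharp_formP.
Qed.
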